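(* Let $s\ge 1$ be an integer and let $\mathbf p\in(0,1)$ be a fixed position (not depending on $n$). For integers $n>s$ and $v>0$ let $\omega_j$, $\mathbf c=\mathbf c(\mathbf p,n)$, $A=A(\mathbf p,v,n)$ be as in the context, let $$Z=\operatorname{diag}(\Omega_s^{-2},\,0_{n-s})\oplus 0_n,\qquad \Omega_s=\operatorname{diag}(\omega_1,\dots,\omega_s),$$ and let $X(\mathbf p,v,s)\in\mathbb R^{2n\times 2n}$ (which also depends on $n$) be the solution of the Lyapunov equation $$A\,X(\mathbf p,v,s)+X(\mathbf p,v,s)\,A^T=-Z .$$ Let $v_{\rm opt}=\operatorname{argmin}_{v}\operatorname{trace}(X(\mathbf p,v,s))$ (minimum over $v>0$) be the optimal viscosity for the position $\mathbf p$ and the given $s$. Then $$\lim_{n\to\infty}\frac{\operatorname{trace}\big(X(\mathbf p,v_{\rm opt},s)\big)}{n^3}=\xi(\mathbf p,s),$$ where $\xi(\mathbf p,s)$ is a function that is independent of $n$.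
   Context: Discrete mass–spring chain with unit masses and unit stiffnesses and one damper, written in modal coordinates. For $n\in\mathbb N$ set $$\omega_j=\omega_j(n)=2\sin\frac{j\pi}{2(n+1)},\quad j=1,\dots,n,\qquad \Omega=\operatorname{diag}(\omega_1,\dots,\omega_n).$$ For a position $\mathbf p\in(0,1)$ (a damper at the $k$-th mass corresponds to $\mathbf p=k/n$) the damping vector is $\mathbf c=\mathbf c(\mathbf p,n)=[c_1,\dots,c_n]^T$ with $$c_j=c_j(\mathbf p,n)=\sqrt{\tfrac{2}{n+1}}\,\sin\frac{j\,\mathbf p\, n\,\pi}{n+1},\qquad j=1,\dots,n.$$ For a viscosity $v>0$, $$A=\begin{bmatrix}0&\Omega\\ -\Omega& -v\,\mathbf c\,\mathbf c^T\end{bmatrix}\in\mathbb R^{2n\times 2n}.$$ Standing assumption: $c_j(\mathbf p,n)\ne 0$ for all $j=1,\dots,n$; only dimensions $n$ for which this holds are considered. The symbol $\oplus$ denotes the block-diagonal direct sum of matrices, $0_m$ the $m\times m$ zero matrix.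
   Formalization: The limit ξ(p,s) is taken in the extended reals and claimed finite only when sin(jpπ) ≠ 0 for j = 1,…,s; otherwise (e.g. p = 1/2, s = 2) trace/n³ tends to +∞, so a finite limit for every p is false. The limit runs over the n > s with all c_j(p,n) ≠ 0. *)

(* Defs.v *)
From mathcomp Require Import all_boot all_order all_algebra.
From mathcomp Require Import all_classical all_reals all_analysis.
Import Order.TTheory GRing.Theory Num.Theory numFieldNormedType.Exports.

Set Implicit Arguments.
Unset Strict Implicit.
Unset Printing Implicit Defensive.

Local Open Scope classical_set_scope.
Local Open Scope ring_scope.

(* Modes are numbered j = 1, ..., n: the coordinate i : 'I_n of a vector or
   matrix carries the mode number i.+1. *)

Definition omega (R : realType) (n j : nat) : R :=
  2 * sin (j%:R * pi / (2 * (n.+1)%:R)).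

Definition damp (R : realType) (p : R) (n j : nat) : R :=
  Num.sqrt (2 / (n.+1)%:R) * sin (j%:R * p * n%:R * pi / (n.+1)%:R).

Definition Omega (R : realType) (n : nat) : 'M[R]_n :=
  diag_mx (\row_(i < n) omega R n i.+1).

Definition dampv (R : realType) (p : R) (n : nat) : 'cV[R]_n :=
  \col_(i < n) damp p n i.+1.

Definition sysA (R : realType) (p v : R) (n : nat) : 'M[R]_(n + n) :=
  block_mx 0           (Omega R n)
           (- Omega R n) (- (v *: (dampv p n *m (dampv p n)^T))).

Definition rhsZ (R : realType) (s n : nat) : 'M[R]_(n + n) :=
  block_mx
    (diag_mx (\row_(i < n) if (i.+1 <= s)%N then (omega R n i.+1) ^- 2 else 0))
    0 0 0.

Definition lyapunov (R : realType) (p v : R) (s n : nat) (X : 'M[R]_(n + n)) :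
    Prop :=
  sysA p v n *m X + X *m (sysA p v n)^T = - rhsZ R s n.

(* The value is arbitrary unless the equation has exactly one solution. *)
Definition lyapX (R : realType) (p v : R) (s n : nat) : 'M[R]_(n + n) :=
  xget 0 [set X | lyapunov p v s X].

Definition is_vopt (R : realType) (p : R) (s n : nat) (v : R) : Prop :=
  0 < v /\
  forall w : R, 0 < w -> \tr (lyapX p v s n) <= \tr (lyapX p w s n).

(* The value is arbitrary unless there is exactly one minimizer. *)
Definition vopt (R : realType) (p : R) (s n : nat) : R :=
  xget 0 [set v | is_vopt p s n v].

Definition admissible (R : realType) (p : R) (s : nat) : set nat :=
  [set n | (s < n)%N /\
           forall j : nat, (1 <= j <= n)%N -> damp p n j != 0].

(* The position p is not a node of any of the first s modes of the limiting
   string: sin (j p pi) is the limit of sqrt ((n + 1) / 2) * c_j(p, n) as n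
   tends to infinity.  It can vanish although every c_j(p, n) is nonzero, for
   instance for p = 1/2 and j = 2. *)
Definition off_node (R : realType) (p : R) (s : nat) : Prop :=
  forall j : nat, (1 <= j <= s)%N -> sin (j%:R * p * pi) != 0.

(* Main.v *)
(* Write l = omega^2, d = c^2 and Z = diag(z) (+) 0.  Comparing the blocks of the
   Lyapunov equation entry by entry determines X completely, because the l_j are
   pairwise distinct and the c_j nonzero, and one finds trace X = a / v + b v with
     a = sum_m z_m / d_m,
     b = sum_m z_m (l_m G_m^2 / d_m + d_m / (2 l_m) + 2 l_m L_m + l_m d_m K_m),
   where G_m, L_m, K_m are the sums over j <> m of d_j / (l_m - l_j),
   d_j / (l_m - l_j)^2 and 1 / (l_m - l_j)^2.  Every term is nonnegative, so
   v = sqrt (a / b) is the only minimizer, with value 2 sqrt (a b).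
   With N = n + 1, both N^2 l_j and N d_j converge, and the spectral gap bound
   N^2 |l_m - l_j| >= (m - j)^2 / 4 gives summable majorants, so a / N^3 and
   b / N^3 converge by Tannery's theorem when p is off the nodes of the first s
   modes.  Otherwise N^3 l_m d_m tends to 0 for some m <= s, so a / N^3 tends to
   infinity, while b / N^3 stays bounded below by the first mode. *)
Require Import Defs.
From mathcomp Require Import all_boot all_order all_algebra.
From mathcomp Require Import all_classical all_reals all_analysis.
From mathcomp Require Import ring lra zify.
Import Order.TTheory GRing.Theory Num.Theory numFieldNormedType.Exports.
Set Implicit Arguments.
Unset Strict Implicit.
Unset Printing Implicit Defensive.
Local Open Scope classical_set_scope.
Local Open Scope ring_scope.

(** * Algebraic identities for sums of reciprocal spectral gaps *)

Section GapSums.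
Variables (F : realFieldType) (n : nat) (l d : 'I_n -> F).
Hypothesis l_inj : injective l.
Hypothesis l_neq0 : forall i, l i != 0.
Hypothesis d_neq0 : forall i, d i != 0.

(* The junk value [0^-1 = 0] makes [gap i i = 0], so that sums over [j != i]
   need no side condition. *)
Definition gap i j : F := (l i - l j)^-1.

Lemma gapii i : gap i i = 0.
Proof. by rewrite /gap subrr invr0. Qed.

Lemma gapC i j : gap i j = - gap j i.
Proof. by rewrite /gap -invrN opprB. Qed.

Lemma subl_neq0 i j : i != j -> l i - l j != 0.
Proof. by rewrite subr_eq0; apply: contra_neq; apply: l_inj. Qed.

Lemma mul_gap i j : i != j -> (l i - l j) * gap i j = 1.
Proof. by move=> ij; rewrite divff // subl_neq0. Qed.

Definition gapG m := \sum_j d j * gap m j.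
Definition gapH m := \sum_j gap m j.
Definition gapL m := \sum_j d j * gap m j ^+ 2.
Definition gapK m := \sum_j gap m j ^+ 2.

(** In [sol_trace], the coefficient of [v] turns out to be [-2] times the sum of [rho i * gapE i],
    where [rho i] rescales the [i]-th entry of [Q c]. *)
Definition gapE m := \sum_k (d m + d k) * gap m k + d m / (2 * l m).

Lemma gapE_GH m : gapE m = gapG m + d m * gapH m + d m / (2 * l m).
Proof.
rewrite /gapE /gapG /gapH mulr_sumr -big_split /=; congr (_ + _).
by apply: eq_bigr => k _; ring.
Qed.

(* The last three terms are the corrections forced by the junk value of [gap]. *)
Lemma gap_partial_fractions m j k :
  gap j k * (gap j m - gap k m) =
  - (gap m j * gap m k) + (j == k)%:R * gap m j ^+ 2 +
  (k == m)%:R * gap m j ^+ 2 + (j == m)%:R * gap m k ^+ 2.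
Proof.
have [->|jk] := eqVneq j k.
  have [->|km] := eqVneq k m; rewrite ?eqxx !gapii /=; ring.
have [<-|km] := eqVneq k m.
  rewrite (negPf jk) !gapii (gapC k j) /=; ring.
have [->|jm] := eqVneq j m.
  rewrite ?eqxx !gapii (gapC k m) /=; ring.
rewrite (gapC j m) (gapC k m) /gap /=; field.
by rewrite !subl_neq0 // eq_sym.
Qed.

Lemma sum_delta (f : 'I_n -> F) i : \sum_j (j == i)%:R * f j = f i.
Proof.
rewrite (bigD1 i) //= eqxx mul1r big1 ?addr0 // => j /negPf ->.
by rewrite mul0r.
Qed.

(* Symmetrizing the double sum in [j] and [k] turns the product of two gaps into
   a partial fraction. *)
Lemma sum_gapE_gap m : \sum_j gap j m * \sum_k (d j + d k) * gap j k =
  2 * gapL m + d m * gapK m - gapG m * gapH m.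
Proof.
set S := LHS.
have S1 : S = \sum_j \sum_k (d j + d k) * (gap j k * gap j m).
  by apply: eq_bigr => j _; rewrite mulr_sumr; apply: eq_bigr => k _; ring.
have S2 : S = \sum_j \sum_k (d j + d k) * (gap j k * - gap k m).
  rewrite S1 exchange_big /=; apply: eq_bigr => j _; apply: eq_bigr => k _.
  rewrite (gapC k j); ring.
have : 2 * S = \sum_j \sum_k (d j + d k) * (- (gap m j * gap m k) +
     (j == k)%:R * gap m j ^+ 2 + (k == m)%:R * gap m j ^+ 2 +
     (j == m)%:R * gap m k ^+ 2).
  rewrite mulr_natl mulr2n {1}S1 S2 -big_split; apply: eq_bigr => j _.
  rewrite -big_split; apply: eq_bigr => k _ /=.
  rewrite -gap_partial_fractions; ring.
have -> : \sum_j \sum_k (d j + d k) * (- (gap m j * gap m k) +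
     (j == k)%:R * gap m j ^+ 2 + (k == m)%:R * gap m j ^+ 2 +
     (j == m)%:R * gap m k ^+ 2) =
   \sum_j \sum_k (- (d j * gap m j) * gap m k) +
   \sum_j \sum_k (- gap m j) * (d k * gap m k) +
   \sum_j \sum_k (k == j)%:R * ((d j + d k) * gap m j ^+ 2) +
   \sum_j \sum_k (k == m)%:R * ((d j + d k) * gap m j ^+ 2) +
   \sum_j \sum_k (j == m)%:R * ((d j + d k) * gap m k ^+ 2).
  rewrite -!big_split; apply: eq_bigr => j _ /=.
  rewrite -!big_split; apply: eq_bigr => k _ /=.
  rewrite (eq_sym k j); ring.
rewrite [X in _ = _ + X -> _]exchange_big /=.
under eq_bigr do rewrite -mulr_sumr.
rewrite -mulr_suml.
under [X in _ + X + _ + _ + _]eq_bigr do rewrite -mulr_sumr.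
rewrite -mulr_suml.
under [X in _ + _ + X + _ + _]eq_bigr do rewrite sum_delta.
under [X in _ + _ + _ + X + _]eq_bigr do rewrite sum_delta.
under [X in _ + _ + _ + _ + X]eq_bigr do rewrite sum_delta.
have -> : \sum_j - (d j * gap m j) = - gapG m by rewrite sumrN.
have -> : \sum_j - gap m j = - gapH m by rewrite sumrN.
have -> : \sum_j (d j + d j) * gap m j ^+ 2 = 2 * gapL m.
  by rewrite mulr_sumr; apply: eq_bigr => j _; ring.
have -> : \sum_j (d j + d m) * gap m j ^+ 2 = gapL m + d m * gapK m.
  by rewrite mulr_sumr -big_split; apply: eq_bigr => j _ /=; ring.
have -> : \sum_j (d m + d j) * gap m j ^+ 2 = gapL m + d m * gapK m.
  by rewrite mulr_sumr -big_split; apply: eq_bigr => j _ /=; ring.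
rewrite -/(gapG m) -/(gapH m) => S3.
have n2 : (2 : F) != 0 by rewrite pnatr_eq0.
by apply: (mulfI n2); rewrite S3; ring.
Qed.

(** The weight [d j + d k] is symmetric and [gap j k] antisymmetric, so their double sum cancels. *)
Lemma sum_gapE : \sum_j gapE j = \sum_j d j / (2 * l j).
Proof.
rewrite big_split /=; set S := (X in X + _).
suff e : S = - S by rewrite (_ : S = 0) ?add0r //; lra.
rewrite {1}/S exchange_big -sumrN; apply: eq_bigr => j _.
by rewrite -sumrN; apply: eq_bigr => k _ /=; rewrite (gapC k j); ring.
Qed.

(** The left side is the coefficient of [z m] in [gap_weighted_sum]. The factor [l j] is removed by
    partial fractions, leaving sums already evaluated in [sum_gapE] and [sum_gapE_gap]. *)
Lemma gapE_identity m :
  gapE m * (1 + l m * gapG m / d m) + \sum_j l j * gapE j * gap j m =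
  l m * gapG m ^+ 2 / d m + d m / (2 * l m) + 2 * l m * gapL m +
  l m * d m * gapK m.
Proof.
(* For [j != m], [l j * gap j m = 1 + l m * gap j m]; the term [- gapE m] compensates for the zero
   value of [gap m m]. *)
have e1 : \sum_j l j * gapE j * gap j m =
   - gapE m + \sum_j gapE j + l m * \sum_j gapE j * gap j m.
  rewrite mulr_sumr -(sum_delta gapE m) -sumrN -!big_split /=.
  apply: eq_bigr => j _; have [->|jm] := eqVneq j m.
    by rewrite gapii /=; ring.
  have := mul_gap jm => e.
  have -> : l j * gapE j * gap j m =
    gapE j * ((l j - l m) * gap j m) + l m * (gapE j * gap j m) by ring.
  by rewrite e /=; ring.
(* For [j != m], [l m / (l j * (l j - l m)) = 1 / (l j - l m) - 1 / l j]; the term [d m / (2 * l m)]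
   restores the index [j = m]. *)
have e2 : l m * \sum_j d j / (2 * l j) * gap j m =
  d m / (2 * l m) - \sum_j d j / (2 * l j) - gapG m / 2.
  rewrite -(sum_delta (fun m => d m / (2 * l m)) m) /gapG mulr_suml mulr_sumr.
  rewrite -!sumrN -!big_split /=; apply: eq_bigr => j _.
  have [->|jm] := eqVneq j m; first by rewrite gapii /=; ring.
  rewrite (gapC m j) /gap /=; field.
  by rewrite l_neq0 subl_neq0.
have e3 : \sum_j gapE j * gap j m =
  \sum_j gap j m * (\sum_k (d j + d k) * gap j k) +
  \sum_j d j / (2 * l j) * gap j m.
  by rewrite -big_split; apply: eq_bigr => j _ /=; rewrite /gapE; ring.
rewrite e1 e3 (mulrDr (l m)) e2 sum_gapE sum_gapE_gap gapE_GH; field.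
by rewrite l_neq0 d_neq0.
Qed.

(** Exchanging the sums collects the coefficient of each [z m]. The right side makes visible that
    the slope is nonnegative for nonnegative data. *)
Lemma gap_weighted_sum (z : 'I_n -> F) :
  \sum_i gapE i * (z i + l i * \sum_j (z j + z i * d j / d i) * gap i j) =
  \sum_m z m * (l m * gapG m ^+ 2 / d m + d m / (2 * l m) +
                2 * l m * gapL m + l m * d m * gapK m).
Proof.
under [RHS]eq_bigr do rewrite -gapE_identity mulrDr [X in _ + X]mulr_sumr.
rewrite big_split /= [X in _ = _ + X]exchange_big -big_split /=.
apply: eq_bigr => i _.
have -> : \sum_j (z j + z i * d j / d i) * gap i j =
   z i / d i * gapG i + \sum_j z j * gap i j.
  by rewrite /gapG mulr_sumr -big_split; apply: eq_bigr => j _ /=; ring.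
move: (gapE i) => e; rewrite !mulrDr addrA; congr (_ + _); first by ring.
rewrite mulrA mulr_sumr; apply: eq_bigr => j _; ring.
Qed.

End GapSums.

(** * The Lyapunov equation written entry by entry *)

Section LyapunovBlocks.
Variables (F : realFieldType) (n : nat) (w c z : 'I_n -> F) (v : F).

Definition modalA : 'M[F]_(n + n) :=
  block_mx 0 (diag_mx (\row_i w i)) (- diag_mx (\row_i w i))
    (- (v *: ((\col_i c i) *m (\col_i c i)^T))).

Definition modalZ : 'M[F]_(n + n) := block_mx (diag_mx (\row_i z i)) 0 0 0.

Lemma modal_lyapunovP (P Q Y W : 'M[F]_n) :
  let X := block_mx P Q Y W in
  modalA *m X + X *m modalA^T = - modalZ <->
  forall i j,
    [/\ w i * Y i j + Q i j * w j = - (z i *+ (i == j)),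
        w i * W i j - P i j * w j = v * (\sum_k Q i k * c k) * c j,
        W i j * w j - w i * P i j = v * c i * (\sum_k c k * Y k j) &
        w i * Q i j + Y i j * w j = - v * (c i * (\sum_k c k * W k j) +
                                        (\sum_k W i k * c k) * c j)].
Proof.
set D := diag_mx (\row_i w i); set C := (\col_i c i) *m (\col_i c i)^T.
have At : modalA^T = block_mx 0 (- D) D (- (v *: C)).
  rewrite tr_block_mx trmx0; congr block_mx; apply/matrixP => i j.
  - by rewrite !mxE; case: eqVneq => [->|ji]; rewrite ?eqxx // eq_sym (negPf ji).
  - by rewrite !mxE; case: eqVneq => [->|ji]; rewrite ?eqxx // eq_sym (negPf ji).
  - by rewrite !mxE !big_ord1 !mxE [c j * _]mulrC.
rewrite /= At /modalA /modalZ -/D -/C !mulmx_block add_block_mx opp_block_mx.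
rewrite !(mul0mx, mulmx0) !add0r !oppr0.
rewrite !mulNmx !mulmxN -!scalemxAl -!scalemxAr.
have Dl (M : 'M[F]_n) i j : (D *m M) i j = w i * M i j.
  by rewrite mul_diag_mx !mxE.
have Dr (M : 'M[F]_n) i j : (M *m D) i j = M i j * w j.
  by rewrite mul_mx_diag !mxE.
have Cl (M : 'M[F]_n) i j :
  (C *m M) i j = c i * \sum_k c k * M k j.
  rewrite -mulmxA mxE big_ord1 !mxE; congr (_ * _).
  by apply: eq_bigr => k _; rewrite !mxE.
have Cr (M : 'M[F]_n) i j :
  (M *m C) i j = (\sum_k M i k * c k) * c j.
  rewrite mulmxA mxE big_ord1 !mxE; congr (_ * _).
  by apply: eq_bigr => k _; rewrite !mxE.
have Da (M N : 'M[F]_n) i j : (M + N) i j = M i j + N i j by rewrite mxE.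
have Dn (M : 'M[F]_n) i j : (- M) i j = - M i j by rewrite mxE.
have Dz (M : 'M[F]_n) i j : (v *: M) i j = v * M i j by rewrite mxE.
have D0 i j : (0 : 'M[F]_n) i j = 0 by rewrite mxE.
split=> [/eq_block_mx[e1 e2 e3 e4] i j|e].
  move/matrixP/(_ i j): e1; move/matrixP/(_ i j): e2.
  move/matrixP/(_ i j): e3; move/matrixP/(_ i j): e4.
  rewrite !(Da, Dn, Dz, Dl, Dr, Cl, Cr, D0) ?mxE => e4 e3 e2 e1.
  split; [exact: e1|lra|lra|lra].
congr block_mx; apply/matrixP => i j; have [e1 e2 e3 e4] := e i j;
  rewrite !(Da, Dn, Dz, Dl, Dr, Cl, Cr, D0) ?mxE.
- exact: e1.
- lra.
- lra.
- lra.
Qed.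
End LyapunovBlocks.


(** * Explicit solution, uniqueness and trace *)

Section LyapunovSolution.
Variables (F : realFieldType) (n : nat) (w c z : 'I_n -> F) (v : F).
Let l i := w i ^+ 2.
Let d i := c i ^+ 2.
Hypothesis l_inj : injective l.
Hypothesis w_neq0 : forall i, w i != 0.
Hypothesis c_neq0 : forall i, c i != 0.
Hypothesis v_neq0 : v != 0.

Let t i := z i / (2 * c i).

(* The diagonals of the (1,1) and (2,2) blocks give that of [Q] and
   [W c = t / v], the off-diagonal part of the (2,2) block gives the rest of [Q],
   the (1,2) block gives [P] and [W] off the diagonal, and [W c] then fixes the
   diagonal of [W]. *)
Definition solQ : 'M[F]_n := \matrix_(i, j)
  (- w i * (c i * t j + t i * c j) * gap l i j -
   (i == j)%:R * (z i / (2 * w i))).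

Let r i := \sum_k solQ i k * c k.

Definition solW' i j : F := (w i * r i * c j - w j * r j * c i) * gap l i j.

Let q i := (t i / v - v * \sum_k solW' i k * c k) / c i.

Definition solW : 'M[F]_n := \matrix_(i, j) (v * solW' i j + (i == j)%:R * q i).

Definition solP : 'M[F]_n := \matrix_(i, j)
  (v * ((w j * r i * c j - w i * r j * c i) * gap l i j) +
   (i == j)%:R * (q i - v * r i * c i / w i)).

Definition sol : 'M[F]_(n + n) := block_mx solP solQ solQ^T solW.

Lemma solW_sym i j : solW i j = solW j i.
Proof.
rewrite !mxE /solW' (gapC l i j) (eq_sym j i).
by have [->|_] := eqVneq i j; rewrite ?gapii /=; ring.
Qed.

Lemma solP_sym i j : solP i j = solP j i.
Proof.
rewrite !mxE (gapC l i j) (eq_sym j i).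
by have [->|_] := eqVneq i j; rewrite ?gapii /=; ring.
Qed.

Lemma solW_c i : \sum_k solW i k * c k = t i / v.
Proof.
have -> : \sum_k solW i k * c k =
    v * (\sum_k solW' i k * c k) + \sum_k (k == i)%:R * (q i * c k).
  rewrite mulr_sumr -big_split; apply: eq_bigr => k _ /=.
  by rewrite mxE (eq_sym k); ring.
by rewrite sum_delta /q; field; rewrite v_neq0 c_neq0.
Qed.

Lemma sol_lyapunov : modalA w c v *m sol + sol *m (modalA w c v)^T = - modalZ z.
Proof.
(* The (1,2) equation comes first: by symmetry of [solW] and [solP], the (2,1) equation is its
   transpose. *)
have e2 i j : w i * solW i j - solP i j * w j =
    v * (\sum_k solQ i k * c k) * c j.
  rewrite -/(r i) !mxE /solW'; have [<-|ij] := eqVneq i j.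
    by rewrite !gapii /=; field; rewrite w_neq0.
  rewrite /gap /l /=; field.
  by rewrite w_neq0; apply: (subl_neq0 l_inj ij).
apply/modal_lyapunovP => i j; split.
- rewrite !mxE (eq_sym j i) (gapC l j i); have [<-|ij] := eqVneq i j.
    by rewrite !gapii /=; field; rewrite w_neq0.
  by rewrite /=; ring.
- exact: e2.
- have := e2 j i; rewrite solW_sym (solP_sym j i) (mulrC (w j)) (mulrC _ (w i)).
  move=> ->; rewrite mulrAC; congr (_ * _).
  by apply: eq_bigr => k _; rewrite [solQ^T _ _]mxE mulrC.
- have -> : \sum_k c k * solW k j = t j / v.
    by rewrite -solW_c; apply: eq_bigr => k _; rewrite mulrC solW_sym.
  rewrite solW_c !mxE (eq_sym j i) (gapC l j i).
  have [<-|ij] := eqVneq i j.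
    by rewrite !gapii /= /t; field; rewrite w_neq0 c_neq0 v_neq0.
  rewrite /gap /l /=; field.
  by rewrite ?w_neq0 ?c_neq0 v_neq0 ?andbT /=; apply: (subl_neq0 l_inj ij).
Qed.

(** Applied to the difference of two solutions, this gives uniqueness. The argument is entrywise
    algebra, in place of a stability argument for the system matrix. *)
Lemma lyapunov_injective (X : 'M[F]_(n + n)) :
  modalA w c v *m X + X *m (modalA w c v)^T = 0 -> X = 0.
Proof.
rewrite -(submxK X).
set P := ulsubmx X; set Q := ursubmx X; set Y := dlsubmx X; set W := drsubmx X.
(* The zero right side is presented as [modalZ] with zero weights, so that [modal_lyapunovP]
   applies. *)
have Z0 : - modalZ (fun=> 0 : F) = 0 :> 'M[F]_(n + n).
  rewrite /modalZ opp_block_mx !oppr0 -[RHS]block_mx0; congr block_mx.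
  by apply/matrixP => i j; rewrite !mxE mul0rn oppr0.
rewrite -{1}Z0 => /modal_lyapunovP e.
(* [T] is the matrix of [Omega^-1 Q]; it turns out to be symmetric, which forces
   [Q c = 0] and makes every block vanish. *)
pose T i j := Q i j / w i.
have QE i j : Q i j = w i * T i j by rewrite /T mulrC divfK.
clearbody T.
have YE i j : Y i j = - (T i j * w j).
  have [e1 _ _ _] := e i j; apply: (mulfI (w_neq0 i)).
  by move: e1; rewrite QE mul0rn oppr0 => /eqP; rewrite addr_eq0 => /eqP ->; ring.
pose u i := \sum_k W i k * c k.
(* On the diagonal the (1,2) and (2,1) equations have the same left side. *)
have diag i : \sum_k c k * Y k i = \sum_k Q i k * c k.
  have [_ e2 e3 _] := e i i.
  apply: (mulfI (c_neq0 i)); apply: (mulfI v_neq0).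
  by rewrite mulrA -e3 [RHS]mulrA [RHS]mulrAC -e2; ring.
(* On the diagonal [Y i i = - Q i i], so the left side of the (2,2) equation vanishes. *)
have uE i : \sum_k c k * W k i = - u i.
  have [_ _ _ e4] := e i i.
  have : - v * (c i * (\sum_k c k * W k i) + u i * c i) = 0.
    by rewrite -e4 QE YE; ring.
  move/eqP; rewrite mulf_eq0 oppr_eq0 (negPf v_neq0) /= mulrC -mulrDl mulf_eq0.
  by rewrite (negPf (c_neq0 i)) orbF addr_eq0 => /eqP.
(* By [uE], the (2,2) equation reads [(l i - l j) * T i j = v * (c i * u j - u i * c j)], and both
   factors that depend on the order of [i] and [j] change sign under exchange. *)
have Tsym i j : T i j = T j i.
  have [->//|ij] := eqVneq i j.
  have [_ _ _ e4] := e i j; have [_ _ _ e4'] := e j i.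
  move: e4 e4'; rewrite !uE -/(u i) -/(u j) !QE !YE => e4 e4'.
  apply: (mulfI (subl_neq0 l_inj ij)); rewrite /l.
  lra.
have r0 i : \sum_k Q i k * c k = 0.
  have := diag i; have -> : \sum_k c k * Y k i = - \sum_k Q i k * c k.
    by rewrite -sumrN; apply: eq_bigr => k _; rewrite YE QE Tsym; ring.
  by move=> h; lra.
have WP i j : w i * W i j = P i j * w j.
  by have [_ e2 _ _] := e i j; move: e2; rewrite r0; lra.
have PW i j : W i j * w j = w i * P i j.
  by have [_ _ e3 _] := e i j; move: e3; rewrite diag r0; lra.
(* Now [WP] and [PW] give [l i * W i j = l j * W i j]. *)
have W0 i j : i != j -> W i j = 0.
  move=> ij; apply: (mulfI (subl_neq0 l_inj ij)); rewrite /l mulr0.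
  have -> : (w i ^+ 2 - w j ^+ 2) * W i j =
     w i * (w i * W i j) - w j * (W i j * w j) by ring.
  by rewrite WP PW; ring.
have uW i : u i = W i i * c i.
  by rewrite /u (bigD1 i) //= big1 ?addr0 // => k ki; rewrite W0 ?mul0r // eq_sym.
have Wii i : W i i = 0.
  have := uE i; rewrite (bigD1 i) //= big1 ?addr0 => [|k ki].
    rewrite uW => h; apply: (mulIf (c_neq0 i)); lra.
  by rewrite W0 ?mulr0.
have {}W0 : W = 0.
  apply/matrixP => i j; rewrite [RHS]mxE.
  by have [->|/W0//] := eqVneq i j.
have P0 : P = 0.
  apply/matrixP => i j; apply: (mulIf (w_neq0 j)).
  by rewrite -WP W0 !mxE; ring.
have T0 i j : i != j -> T i j = 0.
  move=> ij; apply: (mulfI (subl_neq0 l_inj ij)); rewrite /l.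
  have [_ _ _ e4] := e i j.
  by move: e4; rewrite uE -/(u i) !uW !Wii QE YE; lra.
have {}T0 i j : T i j = 0.
  have [<-|/T0//] := eqVneq i j.
  have := r0 i; rewrite (bigD1 i) //= big1 ?addr0 => [|k ki].
    rewrite QE => /eqP; rewrite !mulf_eq0 (negPf (w_neq0 i)) (negPf (c_neq0 i)).
    by rewrite orbF => /eqP.
  by rewrite QE T0 1?eq_sym //; ring.
have -> : Q = 0 by apply/matrixP => i j; rewrite QE T0 mxE mulr0.
have -> : Y = 0 by apply/matrixP => i j; rewrite YE T0 mxE mul0r oppr0.
by rewrite W0 P0 block_mx0.
Qed.

Definition trace_pole := \sum_i z i / d i.
Definition trace_slope := \sum_m z m * (l m * gapG l d m ^+ 2 / d m +
  d m / (2 * l m) + 2 * l m * gapL l d m + l m * d m * gapK l m).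

(** The [t i / v] part of [q i] produces the pole. What remains is linear in [rho], and
    [gap_weighted_sum] puts it in the form of [trace_slope]. *)
Lemma sol_trace : \tr sol = trace_pole / v + trace_slope * v.
Proof.
have l0 i : l i != 0 by rewrite expf_neq0.
have d0 i : d i != 0 by rewrite expf_neq0.
rewrite /trace_slope -(gap_weighted_sum l_inj l0 d0).
(* With this normalization of [r = Q c], the damping enters only through [d = c ^ 2]. *)
pose rho i := w i * r i / c i.
have rhoE i : rho i = - (z i + l i * \sum_j (z j + z i * d j / d i) * gap l i j) / 2.
  rewrite {1}/rho.
  have -> : r i = - (w i * c i / 2 *
      \sum_j (z j + z i * d j / d i) * gap l i j) - z i * c i / (2 * w i).
    have -> : z i * c i / (2 * w i) = \sum_k (k == i)%:R * (z i / (2 * w i) * c k).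
      by rewrite sum_delta; ring.
    rewrite mulr_sumr -!sumrN -big_split.
    apply: eq_bigr => k _ /=; rewrite !mxE (eq_sym k) /d /t.
    by field; rewrite !c_neq0 w_neq0.
  by rewrite /l; field; rewrite c_neq0 w_neq0.
have q1 : \tr sol = \sum_i (2 * q i - v * r i * c i / w i).
  rewrite mxtrace_block -big_split; apply: eq_bigr => i _ /=.
  by rewrite !mxE /solW' gapii eqxx /=; ring.
(* Antisymmetry of [gap] splits the sum into two; exchanging the indices in the second attaches
   [rho i] to both. *)
have sW : \sum_i \sum_k solW' i k * (c k / c i) =
    \sum_i rho i * \sum_k (d i + d k) * gap l i k.
  have e1 : \sum_i \sum_k solW' i k * (c k / c i) =
      \sum_i \sum_k rho i * (d k * gap l i k) +
      \sum_i \sum_k rho k * (d k * gap l k i).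
    rewrite -big_split; apply: eq_bigr => i _ /=.
    rewrite -big_split; apply: eq_bigr => k _ /=.
    rewrite /solW' /rho /d (gapC l k i); field.
    by rewrite !c_neq0.
  rewrite e1 [X in _ + X]exchange_big -big_split; apply: eq_bigr => i _ /=.
  rewrite -big_split mulr_sumr; apply: eq_bigr => k _ /=; ring.
have -> : \tr sol = trace_pole / v -
      2 * v * (\sum_i \sum_k solW' i k * (c k / c i)) -
      v * \sum_i rho i * (d i / l i).
  rewrite q1 /trace_pole !mulr_suml !mulr_sumr -!sumrN -!big_split /=.
  apply: eq_bigr => i _.
  have -> : \sum_k solW' i k * (c k / c i) = (\sum_k solW' i k * c k) / c i.
    by rewrite mulr_suml; apply: eq_bigr => k _; ring.
  rewrite /q /rho /t /d /l; field.
  by rewrite c_neq0 w_neq0 v_neq0.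
rewrite sW.
suff -> : \sum_i gapE l d i *
      (z i + l i * \sum_j (z j + z i * d j / d i) * gap l i j) =
   - 2 * (\sum_i rho i * \sum_k (d i + d k) * gap l i k) -
      \sum_i rho i * (d i / l i) by ring.
rewrite mulr_sumr -!sumrN -!big_split /=; apply: eq_bigr => i _.
rewrite rhoE /gapE; field.
by rewrite l0.
Qed.

End LyapunovSolution.

(** * Tannery's theorem and elementary sine estimates *)

Section Tannery.
Variable R : realType.

Lemma cvg_sum_ord (k : nat) (f : nat -> nat -> R) (F : nat -> R) :
  (forall j, (j < k)%N -> f^~ j @ \oo --> F j) ->
  (fun n => \sum_(j < k) f n j) @ \oo --> \sum_(j < k) F j.
Proof.
move=> fF; apply: cvg_big => [|[j jk] _]; first exact: add_continuous.
exact: fF.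
Qed.

Lemma tannery (f : nat -> nat -> R) (F M : nat -> R) :
  (forall j, f^~ j @ \oo --> F j) ->
  (\forall n \near \oo, forall j, (j < n)%N -> `|f n j| <= M j) ->
  cvgn (series M) ->
  (fun n => \sum_(j < n) f n j) @ \oo --> limn (series F).
Proof.
move=> fF fM cM.
have FM j : `|F j| <= M j.
  apply: (ler_cvg_to (cvg_norm (fF j)) (cvg_cst (M j))).
  near=> n; have jn : (j < n)%N by near: n; exact: nbhs_infty_gt.
  have fMn : forall i, (i < n)%N -> `|f n i| <= M i by near: n.
  exact: fMn.
have cF : cvgn (series F).
  apply: normed_cvg; apply: (series_le_cvg _ _ FM) => // n.
  exact: le_trans (FM n).
apply/cvgrPdist_lt => e e0.
(* One quarter is spent on the head, one on the tail of [F], and two on the tail of [f n], which is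
   bounded by the difference of two partial sums of [M], each within [e / 4] of the limit. *)
have e4 : 0 < e / 4 by rewrite divr_gt0.
have /cvgrPdist_lt/(_ _ e4) hM := cM.
have /cvgrPdist_lt/(_ _ e4) hF := cF.
have [J _ HJ] := filterI hM hF.
have [/= HJM HJF] := HJ J (leqnn J).
have /cvgrPdist_lt/(_ _ e4) hJ := @cvg_sum_ord J _ _ (fun j _ => fF j).
near=> n.
have Jn : (J <= n)%N by near: n; exact: nbhs_infty_ge.
have [/= HnM _] := HJ n Jn.
have h1 : `|\sum_(j < J) F j - \sum_(j < J) f n j| < e / 4 by near: n.
have fMn : forall j, (j < n)%N -> `|f n j| <= M j by near: n.
have h2 : `|\sum_(J <= j < n) f n j| <= series M n - series M J.
  rewrite sub_series_geq //; apply: le_trans (ler_norm_sum _ _ _) _.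
  rewrite !big_nat; apply: ler_sum => j /andP[_ jn]; exact: fMn.
have -> : \sum_(j < n) f n j = \sum_(j < J) f n j + \sum_(J <= j < n) f n j.
  by rewrite -!(big_mkord xpredT (f n)) -big_cat_nat.
move: HJM HJF HnM h1 h2; rewrite /series /= !big_mkord.
set a := limn _; set b := limn _; move=> {}H1 H2 H3 H4 H5.
move: H1 H2 H3 H4; rewrite !ltr_norml => /andP[? ?] /andP[? ?] /andP[? ?] /andP[? ?].
move: H5; rewrite ler_norml => /andP[? ?].
by apply/andP; split; lra.
Unshelve. all: by end_near. Qed.

(** This telescoping series is the quadratically decaying majorant used in [cvg_igap_sum]. *)
Lemma cvg_series_inv_consecutive :
  cvgn (series (fun j => ((j.+1 * j.+2)%:R)^-1 : R)).
Proof.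
apply: nondecreasing_is_cvgn; first by apply: nondecreasing_series => j _ _.
exists 1 => _ [n _ <-].
have -> : series (fun j => ((j.+1 * j.+2)%:R)^-1 : R) n = 1 - (n.+1%:R)^-1.
  elim: n => [|n IH]; first by rewrite /series /= big_geq // invr1 subrr.
  rewrite seriesSr IH natrM -(natr1 n.+1).
  have : (0 : R) < n.+1%:R by [].
  by move: (n.+1%:R) => a a0; field; rewrite !lt0r_neq0 ?addr_gt0.
by rewrite gerBl invr_ge0.
Qed.

Lemma sin_bounds (x : R) : 0 <= x <= pi / 2 -> x * cos x <= sin x <= x.
Proof.
move=> /andP[]; rewrite le_eqVlt => /predU1P[<- _|x0 xpi].
  by rewrite sin0 !mul0r lexx.
have [|c] := @MVT R sin cos 0 x x0 (fun y _ => is_derive_sin y).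
  by apply: continuous_subspaceT; exact: continuous_sin.
rewrite in_itv /= => /andP[c0 cx]; rewrite sin0 !subr0 => ->.
have pi0 := @pi_gt0 R.
rewrite mulrC ler_pM2r // ger_pMl //=.
rewrite (_ : cos x <= cos c) ?andTb.
  exact: cos_le1.
by apply/ltW; rewrite ltr_cos // in_itv /=; apply/andP; split; lra.
Qed.

(** Use [sin x = 2 * cos (x / 2) * sin (x / 2)]: on this range [cos (x / 2) >= 1 / 2], hence
    [sin (x / 2) >= x / 4] by [sin_bounds]. *)
Lemma sin_ge_quarter (x : R) : 0 <= x <= pi / 2 -> x / 4 <= sin x.
Proof.
move=> /andP[x0 xpi].
have pi0 := @pi_gt0 R.
have c2 (y : R) : 0 <= y <= pi / 4 -> 1 / 2 <= cos y.
  move=> /andP[y0 y4].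
  have cy : 0 <= cos y by apply: cos_ge0_pihalf; apply/andP; split; lra.
  have : 0 <= cos (y *+ 2) by apply: cos_ge0_pihalf; apply/andP; split; lra.
  rewrite cos_mulr2n; nra.
have h : 0 <= x / 2 <= pi / 4 by apply/andP; split; lra.
have h' : 0 <= x / 2 <= pi / 2 by apply/andP; split; lra.
have := c2 _ h; have /andP[] := sin_bounds h'.
have -> : sin x = 2 * cos (x / 2) * sin (x / 2).
  by rewrite -[in LHS](divfK (_ : 2 != 0) x) // mulr_natr sin_mulr2n; ring.
move: (cos _) (sin _) => C S s1 _ c1.
have s2 : x / 4 <= S by apply: le_trans s1; nra.
nra.
Qed.

Lemma cvg_exprn T (F : set_system T) {FF : Filter F} (f : T -> R) (x : R) k :
  f @ F --> x -> (fun t => f t ^+ k) @ F --> x ^+ k.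
Proof.
move=> fx; elim: k => [|k IH].
  by rewrite expr0; under eq_fun do rewrite expr0; exact: cvg_cst.
by rewrite exprS; under eq_fun do rewrite exprS; exact: cvgM.
Qed.

End Tannery.

(** * Rescaled frequencies and weights: gap bounds and limits *)

Section Scaling.
Variables (R : realType) (p : R).

(* Indices are shifted: [j] stands for the mode [j.+1]. *)
Definition freq (n j : nat) : R := (n.+1%:R * omega R n j.+1) ^+ 2.

Definition weight (n j : nat) : R := n.+1%:R * damp p n j.+1 ^+ 2.

Definition freq_lim (j : nat) : R := (j.+1%:R * pi) ^+ 2.

Definition weight_lim (j : nat) : R := 2 * sin (j.+1%:R * p * pi) ^+ 2.

(** The difference of squared sines is [sin (a - b) * sin (a + b)], and [sin (a + b) = sin (a - b) +
    2 * cos a * sin b] is at least [sin (a - b) >= (a - b) / 4]. The constant then follows from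
    [pi >= 2]. *)
Lemma freq_gap (n i j : nat) : (j < i)%N -> (i < n)%N ->
  (i - j)%:R ^+ 2 / 4 <= freq n i - freq n j.
Proof.
move=> ji iN; rewrite /freq /omega.
set N : R := n.+1%:R.
have N0 : 0 < N by [].
set a : R := i.+1%:R * pi / (2 * N); set b : R := j.+1%:R * pi / (2 * N).
have pi0 := @pi_gt0 R; have pi2 := @pi_ge2 R.
have b0 : 0 < b by rewrite divr_gt0 ?mulr_gt0.
have ab : a - b = (i - j)%:R * pi / (2 * N).
  by rewrite /a /b -mulrBl -mulrBl -natrB ?ltnS ?(ltnW ji) // subSS.
have ab0 : 0 < a - b by rewrite ab divr_gt0 ?mulr_gt0 // ltr0n subn_gt0.
have api : a <= pi / 2.
  rewrite /a ler_pdivrMr ?mulr_gt0 // (_ : pi / 2 * (2 * N) = N * pi); last by field.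
  by rewrite ler_pM2r // ler_nat ltnW.
have h : (a - b) / 4 <= sin (a - b) by apply: sin_ge_quarter; apply/andP; split; lra.
have h2 : 0 <= cos a * sin b.
  apply: mulr_ge0; first by apply: cos_ge0_pihalf; apply/andP; split; lra.
  by apply: sin_ge0_pi; apply/andP; split; lra.
have e : (N * (2 * sin a)) ^+ 2 - (N * (2 * sin b)) ^+ 2 =
   4 * N ^+ 2 * (sin (a - b) * (sin (a - b) + 2 * (cos a * sin b))).
  have -> : sin (a - b) * (sin (a - b) + 2 * (cos a * sin b)) =
     sin a ^+ 2 * cos b ^+ 2 - cos a ^+ 2 * sin b ^+ 2.
    by rewrite sinB; ring.
  by rewrite !cos2sin2; ring.
rewrite e.
have h3 : ((a - b) / 4) ^+ 2 <= sin (a - b) * (sin (a - b) + 2 * (cos a * sin b)).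
  rewrite expr2; apply: ler_pM => //; try lra.
apply: le_trans (ler_wpM2l _ h3); last by rewrite mulr_ge0 ?sqr_ge0.
rewrite ab; set k : R := (i - j)%:R.
have -> : 4 * N ^+ 2 * (k * pi / (2 * N) / 4) ^+ 2 = (k ^+ 2 * pi ^+ 2) / 16.
  by field; rewrite gt_eqF.
have : 0 <= k ^+ 2 by rewrite sqr_ge0.
have : 4 <= pi ^+ 2 :> R by nra.
move: (k ^+ 2) (pi ^+ 2) => K P P4 K0; nra.
Qed.

(** With [k = |i - j| >= 1], one has [j + 2 <= k * (i + 3)]. After inversion, the first bound is
    uniform and the second is summable in [j] for fixed [i]. *)
Lemma freq_gap_norm (n i j : nat) : (i < n)%N -> (j < n)%N -> i != j ->
  4^-1 <= `|freq n i - freq n j| /\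
  j.+2%:R ^+ 2 / (4 * i.+3%:R ^+ 2) <= `|freq n i - freq n j|.
Proof.
move=> iN jN ij; set D := `|_|.
have [k [k1 kD kij]] : exists k : nat,
    [/\ (0 < k)%N, k%:R ^+ 2 / 4 <= D & (j <= i + k)%N].
  move: ij; rewrite neq_ltn => /orP[] ij.
    exists (j - i)%N; split; [by rewrite subn_gt0| |by rewrite subnKC // ltnW].
    by apply: le_trans (freq_gap ij jN) _; rewrite /D distrC ler_norm.
  exists (i - j)%N; split; [by rewrite subn_gt0| |].
    by apply: le_trans (freq_gap ij iN) _; rewrite /D ler_norm.
  by rewrite (leq_trans (ltnW ij)) // leq_addr.
have k1R : 1 <= k%:R :> R by rewrite ler1n.
split; first by apply: le_trans kD; nra.
apply: le_trans kD; rewrite ler_pdivrMr ?mulr_gt0 ?exprn_gt0 //.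
have -> : k%:R ^+ 2 / 4 * (4 * i.+3%:R ^+ 2) = (k%:R * i.+3%:R) ^+ 2 :> R by field.
rewrite lerXn2r ?nnegrE ?mulr_ge0 // -natrM ler_nat.
nia.
Qed.

Lemma freq_inj (n i j : nat) : (i < n)%N -> (j < n)%N ->
  freq n i = freq n j -> i = j.
Proof.
move=> iN jN e; apply/eqP/negPn/negP => ij.
have [] := freq_gap_norm iN jN ij.
by rewrite e subrr normr0 => h _; lra.
Qed.

Lemma weight_le2 (n j : nat) : 0 <= weight n j <= 2.
Proof.
rewrite /weight /damp exprMn sqr_sqrtr ?divr_ge0 // mulrA mulrC.
rewrite (mulrC n.+1%:R) divfK ?pnatr_eq0 //.
set s := sin _; have : 0 <= s ^+ 2 <= 1.
  by rewrite sqr_ge0 /s sin2cos2 gerBl sqr_ge0.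
by move=> /andP[? ?]; apply/andP; split; lra.
Qed.

Lemma cvg_div_succ (x : R) : (fun n => x / n.+1%:R) @ \oo --> 0.
Proof.
rewrite -(mulr0 x); apply: cvgM; first exact: cvg_cst.
exact: cvg_harmonic.
Qed.

Lemma cvg_freq j : freq^~ j @ \oo --> freq_lim j.
Proof.
rewrite /freq /freq_lim; set x : R := j.+1%:R * pi.
have pi0 := @pi_gt0 R.
have x0 : 0 < x by rewrite mulr_gt0.
apply: cvg_exprn.
have xN n : j.+1%:R * pi / (2 * n.+1%:R) = (x / 2) / n.+1%:R.
  by rewrite invfM mulrA.
under eq_fun do rewrite /omega xN.
apply: (@squeeze_cvgr _ _ _ _ (fun n => x * cos (x / 2 / n.+1%:R)) (fun=> x)).
- near=> n.
  have jn : (j < n)%N by near: n; exact: nbhs_infty_gt.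
  set N : R := n.+1%:R; have N0 : 0 < N by [].
  have /sin_bounds/andP[] : 0 <= x / 2 / N <= pi / 2.
    apply/andP; split; first by rewrite !divr_ge0 // ltW.
    rewrite ler_pdivrMr // (_ : pi / 2 * N = N * pi / 2); last by ring.
    by rewrite !ler_pM2r ?invr_gt0 // ler_nat ltnW.
  move: (cos _) (sin _) => C S h1 h2.
  have e y : (x / 2 / N) * y * (2 * N) = x * y by field; rewrite gt_eqF.
  have -> : N * (2 * S) = S * (2 * N) by ring.
  apply/andP; split; first by rewrite -e ler_pM2r ?mulr_gt0.
  by rewrite -[leRHS]mulr1 -e mulr1 ler_pM2r ?mulr_gt0.
- rewrite -[X in _ --> X]mulr1; apply: cvgM; first exact: cvg_cst.
  rewrite -[X in _ --> X](@cos0 R); apply: continuous_cvg; first exact: continuous_cos.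
  exact: cvg_div_succ.
- exact: cvg_cst.
Unshelve. all: by end_near. Qed.

Lemma cvg_weight j : weight^~ j @ \oo --> weight_lim j.
Proof.
have e n : weight n j = 2 * sin (j.+1%:R * p * pi - j.+1%:R * p * pi / n.+1%:R) ^+ 2.
  rewrite /weight /damp exprMn sqr_sqrtr ?divr_ge0 // mulrA mulrC.
  rewrite (mulrC n.+1%:R) divfK ?pnatr_eq0 // mulrC; congr (2 * sin _ ^+ 2).
  by rewrite -(natr1 n); field; rewrite natr1 pnatr_eq0.
under eq_fun do rewrite e.
apply: cvgM; first exact: cvg_cst.
apply: cvg_exprn.
apply: continuous_cvg; first exact: continuous_sin.
rewrite -[X in _ --> X]subr0; apply: cvgB; first exact: cvg_cst.
exact: cvg_div_succ.
Qed.

(** This is [gap] divided by [N ^ 2]; it is again zero on the diagonal, so sums may run over all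
    [j < n]. *)
Definition igap n m j : R := (freq n m - freq n j)^-1.

Definition igap_lim m j : R := (freq_lim m - freq_lim j)^-1.

Lemma freq_lim_gt0 j : 0 < freq_lim j.
Proof. by rewrite exprn_gt0 // mulr_gt0 // pi_gt0. Qed.

Lemma cvg_igap m j : (igap^~ m)^~ j @ \oo --> igap_lim m j.
Proof.
have [->|mj] := eqVneq m j.
  rewrite /igap /igap_lim subrr invr0; under eq_fun do rewrite subrr invr0.
  exact: cvg_cst.
apply: cvgV; last by apply: cvgB; exact: cvg_freq.
rewrite subr_eq0 eqrXn2 ?mulr_ge0 ?pi_ge0 //.
have pi_neq0 : pi != 0 :> R by rewrite gt_eqF ?pi_gt0.
by rewrite (inj_eq (mulIf pi_neq0)) eqr_nat eqSS.
Qed.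

Lemma igap_bound n m j : (m < n)%N -> (j < n)%N ->
  `|igap n m j| <= 4 /\
  `|igap n m j| <= 4 * m.+3%:R ^+ 2 * ((j.+1 * j.+2)%:R)^-1.
Proof.
move=> mn jn; rewrite /igap.
have [->|mj] := eqVneq m j.
  by rewrite subrr invr0 normr0; split => //; rewrite !mulr_ge0 ?invr_ge0.
have [h1 h2] := freq_gap_norm mn jn mj; rewrite normrV; last first.
  rewrite unitfE; apply: contraNneq mj => /eqP; rewrite subr_eq0 => /eqP.
  by move/(freq_inj mn jn) => ->.
have D0 : 0 < `|freq n m - freq n j| by apply: lt_le_trans h1.
split; first by rewrite -[leRHS]invrK lef_pV2 ?posrE.
have : `|freq n m - freq n j|^-1 <= (j.+2%:R ^+ 2 / (4 * m.+3%:R ^+ 2))^-1.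
  by rewrite lef_pV2 ?posrE // divr_gt0 ?mulr_gt0 ?exprn_gt0.
move/le_trans; apply; rewrite invf_div ler_pM2l ?mulr_gt0 ?exprn_gt0 //.
by rewrite lef_pV2 ?posrE ?exprn_gt0 // natrM expr2 ler_pM2r // ler_nat.
Qed.

Lemma cvg_igap_sum (a : nat -> nat -> R) (al : nat -> R) k m :
  (0 < k <= 2)%N ->
  (forall j, a^~ j @ \oo --> al j) -> (forall n j, 0 <= a n j <= 2) ->
  (fun n => \sum_(j < n) a n j * igap n m j ^+ k) @ \oo -->
  limn (series (fun j => al j * igap_lim m j ^+ k)).
Proof.
move=> k12 aal a2.
apply: (@tannery _ (fun n j => a n j * igap n m j ^+ k) _
  (* The factor 8 serves both exponents: coefficients are at most 2, and for [k = 2] the extra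
     factor [|igap|] is at most 4. *)
  (fun j => 8 * (4 * m.+3%:R ^+ 2 * ((j.+1 * j.+2)%:R)^-1))).
- by move=> j; apply: cvgM; [exact: aal|apply: cvg_exprn; exact: cvg_igap].
- near=> n => j jn.
  have mn : (m < n)%N by near: n; exact: nbhs_infty_gt.
  have [h1 h2] := igap_bound mn jn.
  have /andP[a0 a2'] := a2 n j.
  rewrite normrM normrX (ger0_norm a0).
  move: k k12 => [|[|[|//]]] // _; have := normr_ge0 (igap n m j).
    by rewrite expr1; move: h1 h2; move: (`|_|) (4 * _ * _) => y z; nra.
  by move: h1 h2; move: (`|_|) (4 * _ * _) => y z; nra.
- under eq_fun do rewrite mulrA.
  exact: (is_cvg_seriesZ (k := 8 * (4 * m.+3%:R ^+ 2))
    (@cvg_series_inv_consecutive R)).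
Unshelve. all: by end_near. Qed.

(** The factor of [z m] in [trace_slope], divided by [l m] and by [N ^ 3]. The division by [l m]
    anticipates [z m = 1 / l m] for the first [s] modes. *)
Definition modeB n m : R :=
  (\sum_(j < n) weight n j * igap n m j) ^+ 2 / weight n m +
  weight n m / (2 * freq n m ^+ 2) +
  2 * (\sum_(j < n) weight n j * igap n m j ^+ 2) +
  weight n m * \sum_(j < n) igap n m j ^+ 2.

Lemma cvg_modeB m : weight_lim m != 0 -> exists l : R, (modeB^~ m) @ \oo --> l.
Proof.
move=> wm.
have cG := @cvg_igap_sum weight weight_lim 1 m isT cvg_weight weight_le2.
have cL := @cvg_igap_sum weight weight_lim 2 m isT cvg_weight weight_le2.
have one2 : forall n j : nat, 0 <= (1 : R) <= 2 by move=> _ _; lra.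
have one1 : forall j : nat, (fun _ : nat => 1 : R) @ \oo --> (1 : R).
  by move=> j; exact: cvg_cst.
have cK := @cvg_igap_sum (fun _ _ => 1) (fun=> 1) 2 m isT one1 one2.
have cw := @cvg_weight m; have cf := @cvg_freq m.
have f0 := freq_lim_gt0 m.
eexists; rewrite /modeB.
apply: cvgD; last first.
  apply: cvgM cw _.
  by under eq_fun do under eq_bigr do rewrite -[_ ^+ 2]mul1r; exact: cK.
apply: cvgD; last by apply: cvgM cL; exact: cvg_cst.
apply: cvgD.
  apply: cvgM; last exact: cvgV cw.
  apply: cvg_exprn; under eq_fun do under eq_bigr do rewrite -[igap _ _ _]expr1.
  exact: cG.
apply: cvgM cw _; apply: cvgV; last first.
  by apply: cvgM; [exact: cvg_cst|exact: cvg_exprn cf].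
by apply: mulf_neq0 => //; apply: expf_neq0; rewrite gt_eqF.
Qed.

(** The retained term gives positivity, and for the first mode it has a positive limit, which keeps
    [sumB] away from zero in the node case. *)
Lemma modeB_ge n m : 0 <= weight n m ->
  weight n m / (2 * freq n m ^+ 2) <= modeB n m.
Proof.
move=> w0; rewrite /modeB.
have h1 : 0 <= (\sum_(j < n) weight n j * igap n m j) ^+ 2 / weight n m.
  by rewrite divr_ge0 ?sqr_ge0.
have h2 : 0 <= \sum_(j < n) weight n j * igap n m j ^+ 2.
  apply: sumr_ge0 => j _; rewrite mulr_ge0 ?sqr_ge0 //.
  by have /andP[] := weight_le2 n j.
have h3 : 0 <= weight n m * \sum_(j < n) igap n m j ^+ 2.
  by rewrite mulr_ge0 // sumr_ge0 // => j _; exact: sqr_ge0.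
lra.
Qed.

End Scaling.

(** * The trace and its minimizer in rescaled quantities *)

Section Linking.
Variables (R : realType) (p : R) (s n : nat).
Hypothesis adm : admissible p s n.

Let w (i : 'I_n) : R := omega R n i.+1.
Let c (i : 'I_n) : R := damp p n i.+1.
Let z (i : 'I_n) : R := if (i.+1 <= s)%N then omega R n i.+1 ^- 2 else 0.
Let N : R := n.+1%:R.

Lemma omega_gt0 (j : nat) : (j < n)%N -> 0 < omega R n j.+1.
Proof.
move=> jn; rewrite mulr_gt0 // sin_gt0_pi // divr_gt0 ?mulr_gt0 ?pi_gt0 //=.
rewrite ltr_pdivrMr ?mulr_gt0 // mulrC ltr_pM2l ?pi_gt0 // -natrM ltr_nat.
by lia.
Qed.

Lemma damp_neq0 (j : nat) : (j < n)%N -> damp p n j.+1 != 0.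
Proof. by move=> jn; apply: adm.2. Qed.

Let w_neq0 i : w i != 0. Proof. by rewrite gt_eqF // omega_gt0. Qed.

Let c_neq0 i : c i != 0. Proof. exact: damp_neq0. Qed.

Let freqE j : freq R n j = N ^+ 2 * omega R n j.+1 ^+ 2.
Proof. by rewrite /freq exprMn. Qed.

Let l_inj : injective (fun i => w i ^+ 2).
Proof.
move=> i j e; apply/val_inj/(@freq_inj R n) => /=; try exact: ltn_ord.
by rewrite !freqE; congr (_ * _).
Qed.

Lemma lyapunov_sol v X : 0 < v -> lyapunov p v s X <-> X = sol w c z v.
Proof.
move=> v0; have v_neq0 : v != 0 by rewrite gt_eqF.
have solP := sol_lyapunov z l_inj w_neq0 c_neq0 v_neq0.
split=> [XP|-> //]; apply/eqP; rewrite -subr_eq0; apply/eqP.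
apply: (lyapunov_injective l_inj w_neq0 c_neq0 v_neq0).
move: XP; rewrite /lyapunov -[sysA p v n]/(modalA w c v).
rewrite -[rhsZ R s n]/(modalZ z) => XP.
by rewrite mulmxBr mulmxBl addrACA -opprD XP solP subrr.
Qed.

Lemma lyapX_sol v : 0 < v -> lyapX p v s n = sol w c z v.
Proof.
move=> v0; apply/(lyapunov_sol _ v0).
apply: (@xgetPex _ 0 [set X | lyapunov p v s X]).
by exists (sol w c z v); exact/lyapunov_sol.
Qed.

Lemma weight_gt0 j : (j < n)%N -> 0 < weight p n j.
Proof. by move=> jn; rewrite mulr_gt0 // exprn_even_gt0 ?damp_neq0. Qed.

Lemma freq_gt0 j : (j < n)%N -> 0 < freq R n j.
Proof. by move=> jn; rewrite exprn_gt0 // mulr_gt0 // omega_gt0. Qed.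

(* [N ^+ 3 * sumA] and [N ^+ 3 * sumB] are the coefficients of [1 / v] and [v] in
   the trace. *)
Definition sumA : R := \sum_(m < s) (freq R n m * weight p n m)^-1.

Definition sumB : R := \sum_(m < s) modeB p n m.

Lemma sum_z (g : nat -> R) : \sum_(i < n) z i * g i =
  \sum_(m < s) omega R n m.+1 ^- 2 * g m.
Proof.
rewrite (big_ord_widen n (fun m => omega R n m.+1 ^- 2 * g m)); last first.
  by case: adm => /ltnW.
rewrite [RHS]big_mkcond; apply: eq_bigr => i _.
by rewrite /z; case: ifP; rewrite ?mul0r.
Qed.

Lemma trace_poleE : trace_pole c z = N ^+ 3 * sumA.
Proof.
rewrite /trace_pole (sum_z (fun m => (damp p n m.+1 ^+ 2)^-1)) mulr_sumr.
apply: eq_bigr => m _; have mn := ltn_trans (ltn_ord m) adm.1.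
rewrite freqE /weight -/N; field.
by rewrite damp_neq0 // !gt_eqF // omega_gt0.
Qed.

(** Since [d] carries [N ^ -1] and [gap] carries [N ^ 2], the sums [gapG], [gapL], [gapK] scale as
    [N], [N ^ 3], [N ^ 4]; every term of the slope is then [l] times [N ^ 3]. *)
Lemma trace_slopeE : trace_slope w c z = N ^+ 3 * sumB.
Proof.
have sn : (s < n)%N by case: adm.
have N0 : N != 0 by rewrite gt_eqF.
pose l i := w i ^+ 2; pose d i := c i ^+ 2.
have gapE' (m j : 'I_n) : gap l m j = N ^+ 2 * igap R n m j.
  rewrite /gap /igap !freqE /l /w -mulrBr -/N invfM mulrA divff ?mul1r //.
  by rewrite expf_neq0.
have dE (j : 'I_n) : d j = weight p n j / N.
  by rewrite /d /c /weight -/N; field.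
have lE (j : 'I_n) : l j = freq R n j / N ^+ 2.
  by rewrite /l /w freqE; field.
have GE m : gapG l d m = N * \sum_(j < n) weight p n j * igap R n m j.
  rewrite /gapG mulr_sumr; apply: eq_bigr => j _; rewrite gapE' dE; field.
  by [].
have LE m : gapL l d m = N ^+ 3 * \sum_(j < n) weight p n j * igap R n m j ^+ 2.
  rewrite /gapL mulr_sumr; apply: eq_bigr => j _; rewrite gapE' dE; field.
  by [].
have KE m : gapK l m = N ^+ 4 * \sum_(j < n) igap R n m j ^+ 2.
  by rewrite /gapK mulr_sumr; apply: eq_bigr => j _; rewrite gapE'; ring.
have -> : trace_slope w c z = \sum_(i < n) z i * (l i * (N ^+ 3 * modeB p n i)).
  rewrite /trace_slope; apply: eq_bigr => i _; congr (_ * _).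
  rewrite -[LHS]/(l i * gapG l d i ^+ 2 / d i + d i / (2 * l i) +
    2 * l i * gapL l d i + l i * d i * gapK l i).
  rewrite GE LE KE dE lE /modeB; field.
  by rewrite nat1r pnatr_eq0 !gt_eqF ?freq_gt0 ?weight_gt0.
rewrite (sum_z (fun m => omega R n m.+1 ^+ 2 * (N ^+ 3 * modeB p n m))) mulr_sumr.
apply: eq_bigr => m _; rewrite mulKf // expf_neq0 // gt_eqF // omega_gt0 //.
exact: ltn_trans (ltn_ord m) sn.
Qed.

Lemma modeB_gt0 m : (m < n)%N -> 0 < modeB p n m.
Proof.
move=> mn; apply: lt_le_trans (modeB_ge (ltW (weight_gt0 mn))).
by rewrite divr_gt0 ?weight_gt0 // mulr_gt0 // exprn_gt0 // freq_gt0.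
Qed.

Lemma le_sumA m : (m < s)%N -> (freq R n m * weight p n m)^-1 <= sumA.
Proof.
move=> ms; rewrite /sumA (bigD1 (Ordinal ms)) //= lerDl sumr_ge0 // => i _.
have im : (i < n)%N by apply: ltn_trans (ltn_ord i) _; case: adm.
by rewrite invr_ge0 mulr_ge0 // ltW ?freq_gt0 ?weight_gt0.
Qed.

Lemma le_sumB m : (m < s)%N -> modeB p n m <= sumB.
Proof.
move=> ms; rewrite /sumB (bigD1 (Ordinal ms)) //= lerDl sumr_ge0 // => i _.
have im : (i < n)%N by apply: ltn_trans (ltn_ord i) _; case: adm.
by rewrite ltW ?modeB_gt0.
Qed.

Lemma trace_lyapX v : 0 < v ->
  \tr (lyapX p v s n) = N ^+ 3 * (sumA / v + sumB * v).
Proof.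
move=> v0; have v_neq0 : v != 0 by rewrite gt_eqF.
rewrite lyapX_sol // (sol_trace z l_inj w_neq0 c_neq0 v_neq0).
rewrite trace_poleE trace_slopeE.
ring.
Qed.

Hypothesis s_gt0 : (0 < s)%N.

Lemma sumA_gt0 : 0 < sumA.
Proof.
apply: lt_le_trans (le_sumA s_gt0).
have n0 : (0 < n)%N by apply: leq_ltn_trans adm.1.
by rewrite invr_gt0 mulr_gt0 ?freq_gt0 ?weight_gt0.
Qed.

Lemma sumB_gt0 : 0 < sumB.
Proof.
apply: lt_le_trans (le_sumB s_gt0); apply: modeB_gt0.
exact: leq_ltn_trans adm.1.
Qed.

Definition vmin : R := Num.sqrt sumA / Num.sqrt sumB.

(** Completing the square: with [x], [y] the roots of [sumA], [sumB], the trace is [N ^ 3 * (2 * x *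
    y + (x - y * v) ^ 2 / v)], minimal exactly when [x = y * v]. *)
Lemma is_voptE v : is_vopt p s n v <-> v = vmin.
Proof.
have a0 := sumA_gt0; have b0 := sumB_gt0.
have N3 : 0 < N ^+ 3 by rewrite exprn_gt0.
rewrite /vmin; set x := Num.sqrt sumA; set y := Num.sqrt sumB.
have x0 : 0 < x by rewrite sqrtr_gt0.
have y0 : 0 < y by rewrite sqrtr_gt0.
have trE u : 0 < u ->
    \tr (lyapX p u s n) = N ^+ 3 * (2 * x * y + (x - y * u) ^+ 2 / u).
  move=> u0; rewrite trace_lyapX // -(sqr_sqrtr (ltW a0)) -(sqr_sqrtr (ltW b0)).
  by rewrite -/x -/y; field; rewrite gt_eqF.
have v0 : 0 < x / y by rewrite divr_gt0.
have trv : \tr (lyapX p (x / y) s n) = N ^+ 3 * (2 * x * y).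
  by rewrite trE //; field; rewrite !gt_eqF.
split=> [[u0 /(_ _ v0)]|->]; last first.
  split=> [//|u u0]; rewrite trv (trE _ u0); apply: ler_wpM2l; first exact: ltW.
  by rewrite lerDl; apply: divr_ge0; [exact: sqr_ge0|exact: ltW].
rewrite trv (trE _ u0) (ler_pM2l N3) gerDl pmulr_lle0 ?invr_gt0 // => h.
have : x - y * v == 0 by rewrite -sqrf_eq0 eq_le h sqr_ge0.
by rewrite subr_eq0 => /eqP ->; rewrite mulrC mulKf // gt_eqF.
Qed.

Lemma trace_vopt :
  \tr (lyapX p (vopt p s n) s n) = N ^+ 3 * (2 * Num.sqrt (sumA * sumB)).
Proof.
have a0 := sumA_gt0; have b0 := sumB_gt0.
have -> : vopt p s n = vmin.
  apply/is_voptE; apply: (@xgetPex _ 0 [set v | is_vopt p s n v]).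
  by exists vmin; exact/is_voptE.
have x0 : 0 < Num.sqrt sumA by rewrite sqrtr_gt0.
have y0 : 0 < Num.sqrt sumB by rewrite sqrtr_gt0.
rewrite trace_lyapX ?divr_gt0 // sqrtrM ?(ltW a0) // /vmin.
move: (sqr_sqrtr (ltW a0)) (sqr_sqrtr (ltW b0)).
move: (Num.sqrt sumA) (Num.sqrt sumB) x0 y0 => x y x0 y0 <- <-.
by field; rewrite !gt_eqF.
Qed.

End Linking.

(** * The limit of the normalized optimal trace, off and on the nodes *)

Section Limit.
Variables (R : realType) (p : R) (s : nat).
Hypotheses (s_gt0 : (0 < s)%N) (p01 : 0 < p < 1).

Let T n : R := \tr (lyapX p (vopt p s n) s n) / n%:R ^+ 3.

Lemma cvg_succ_div : (fun n => n.+1%:R / n%:R : R) @ \oo --> (1 : R).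
Proof.
have e n : n.+1%:R / n%:R = (1 - 1 / n.+1%:R)^-1 :> R.
  case: n => [|n]; first by rewrite divr1 subrr !invr0 mulr0.
  rewrite -(natr1 n.+1); have : (0 : R) < n.+1%:R by [].
  by move: (n.+1%:R) => a a0; field; rewrite addrK !gt_eqF ?addr_gt0.
under eq_fun do rewrite e.
have cB : (fun n => 1 - 1 / n.+1%:R : R) @ \oo --> (1 - 0 : R).
  by apply: cvgB; [exact: cvg_cst|exact: cvg_div_succ].
have := cvgV _ cB; rewrite subr0 invr1; apply; exact: oner_neq0.
Qed.

Lemma scaled_trace n : admissible p s n ->
  T n = 2 * Num.sqrt (sumA p s n * sumB p s n) * (n.+1%:R / n%:R) ^+ 3.
Proof.
by move=> adm; rewrite /T trace_vopt // exprMn exprVn; ring.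
Qed.

(** The closed form of [T] holds only at admissible [n], so its ordinary limit is transferred to the
    restricted filter and into the extended reals. *)
Lemma cvg_T_within (g : nat -> R) (l : R) :
  (forall n, admissible p s n -> T n = g n) -> g @ \oo --> l ->
  (fun n => (T n)%:E) @ within (admissible p s) \oo --> l%:E.
Proof.
move=> Tg gl.
have gE : (fun n => (g n)%:E) @ within (admissible p s) \oo --> l%:E.
  apply: cvg_trans (cvg_app _ (@cvg_within _ _ _ _)) _.
  by apply: cvg_EFin => //; exact: nearW.
apply: cvg_trans gE; apply: near_eq_cvg.
by rewrite near_withinE; apply: nearW => n adm; rewrite Tg.
Qed.

Lemma off_node_cvg : off_node p s ->
  exists l : R, (fun n => (T n)%:E) @ within (admissible p s) \oo --> l%:E.
Proof.
move=> off.
have wl m : (m < s)%N -> weight_lim p m != 0.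
  by move=> ms; apply: mulf_neq0 => //; rewrite expf_neq0 // off.
have /choice[b bP] m : exists l : R, (m < s)%N -> (modeB p)^~ m @ \oo --> l.
  have [ms|ms] := ltnP m s; last by exists 0.
  by have [l lP] := cvg_modeB (wl m ms); exists l.
have cB : (fun n => sumB p s n) @ \oo --> \sum_(m < s) b m.
  exact: cvg_sum_ord bP.
have cA : (fun n => sumA p s n) @ \oo -->
    \sum_(m < s) (freq_lim R m * weight_lim p m)^-1.
  apply: (@cvg_sum_ord _ s (fun n m => (freq R n m * weight p n m)^-1)
    (fun m => (freq_lim R m * weight_lim p m)^-1)) => m ms.
  apply: cvgV; last first.
    by apply: cvgM; [exact: cvg_freq|exact: cvg_weight].
  by apply: mulf_neq0; rewrite ?wl // gt_eqF // freq_lim_gt0.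
eexists; apply: cvg_T_within scaled_trace _.
apply: cvgM.
  apply: cvgM; first exact: cvg_cst.
  apply: continuous_cvg; first exact: sqrt_continuous.
  exact: cvgM cA cB.
by apply: cvg_exprn; exact: cvg_succ_div.
Qed.

Lemma on_node_cvg : ~ off_node p s ->
  (fun n => (T n)%:E) @ within (admissible p s) \oo --> +oo%E.
Proof.
move=> /existsNP[j /not_implyP[/andP[j1 js] /negP/negPn/eqP sj]].
case: j j1 js sj => // m _ ms sm.
have cE : (fun n => freq R n m * weight p n m) @ \oo --> 0.
  rewrite -(mulr0 (freq_lim R m)) (_ : 0 = weight_lim p m); last first.
    by rewrite /weight_lim sm expr2 !mulr0.
  by apply: cvgM; [exact: cvg_freq|exact: cvg_weight].
have cY : (fun n => weight p n 0 / (2 * freq R n 0 ^+ 2)) @ \oo -->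
    weight_lim p 0 / (2 * freq_lim R 0 ^+ 2).
  apply: cvgM; first exact: cvg_weight.
  apply: cvgV; first by rewrite gt_eqF // mulr_gt0 // exprn_gt0 // freq_lim_gt0.
  by apply: cvgM; [exact: cvg_cst|apply: cvg_exprn; exact: cvg_freq].
have Y0 : 0 < weight_lim p 0 / (2 * freq_lim R 0 ^+ 2).
  rewrite divr_gt0 //; last by rewrite mulr_gt0 // exprn_gt0 // freq_lim_gt0.
  rewrite mulr_gt0 // exprn_gt0 // sin_gt0_pi // mul1r.
  have := @pi_gt0 R; case/andP: p01 => p0 p1 pi0.
  by rewrite mulr_gt0 //= gtr_pMl.
apply/cvgeyPge => A.
(* A division-free form of [A ^ 2 <= 4 * sumA * sumB], with both sums replaced by their lower
   bounds; the product [freq * weight] tends to 0, so no inverse has to be taken in the limit. *)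
have near0 : \forall n \near \oo, A ^+ 2 * (freq R n m * weight p n m) -
    4 * (weight p n 0 / (2 * freq R n 0 ^+ 2)) < 0.
  apply: (cvgr_lt (A ^+ 2 * 0 - 4 * (weight_lim p 0 / (2 * freq_lim R 0 ^+ 2)))).
    by apply: cvgB; apply: cvgM => //; exact: cvg_cst.
  by rewrite mulr0 sub0r oppr_lt0 mulr_gt0.
rewrite near_withinE; near=> n => adm.
have n0 : (0 < n)%N by apply: leq_ltn_trans adm.1.
have mn : (m < n)%N by apply: leq_trans (ltnW adm.1).
have h : A ^+ 2 * (freq R n m * weight p n m) -
    4 * (weight p n 0 / (2 * freq R n 0 ^+ 2)) < 0 by near: n.
rewrite lee_fin scaled_trace //.
have e0 : 0 < freq R n m * weight p n m.
  by apply: mulr_gt0; [exact: freq_gt0|have := weight_gt0 adm mn; exact: id].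
have hA := le_sumA adm ms.
have hB := le_trans (modeB_ge (ltW (weight_gt0 adm n0))) (le_sumB adm s_gt0).
have y0 : 0 < weight p n 0 / (2 * freq R n 0 ^+ 2).
  by rewrite divr_gt0 ?(weight_gt0 adm) // mulr_gt0 // exprn_gt0 // freq_gt0.
have AB : A ^+ 2 <= 4 * (sumA p s n * sumB p s n).
  have : A ^+ 2 <= 4 * ((freq R n m * weight p n m)^-1 *
      (weight p n 0 / (2 * freq R n 0 ^+ 2))).
    rewrite mulrCA mulrC ler_pdivlMr //; lra.
  move/le_trans; apply; rewrite ler_pM2l //; apply: ler_pM => //.
    by rewrite invr_ge0 ltW.
  exact: ltW.
have r1 : 1 <= (n.+1%:R / n%:R : R) ^+ 3.
  by rewrite exprn_ege1 // ler_pdivlMr ?ltr0n // mul1r ler_nat.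
have : A <= 2 * Num.sqrt (sumA p s n * sumB p s n).
  (* The threshold [A] may be negative, hence the passage through [|A|], the root of [A ^ 2]. *)
  apply: le_trans (ler_norm A) _; rewrite -sqrtr_sqr.
  rewrite -[2](ger0_norm (_ : 0 <= 2)) // -[`|2|]sqrtr_sqr -sqrtrM ?sqr_ge0 //.
  by apply: ler_wsqrtr; apply: le_trans AB _; rewrite expr2 -natrM.
move/le_trans; apply; rewrite ler_peMr // mulr_ge0 // sqrtr_ge0 //.
Unshelve. all: by end_near. Qed.

End Limit.

(** The values of [xi] are extended reals because the normalized trace tends to infinity at nodes.
    The existence and uniqueness clauses certify that [lyapX] (for positive viscosity) and [vopt]
    are not default values. *)
Theorem theorem2 (R : realType) :
  exists xi : R -> nat -> \bar R,
    forall (s : nat) (p : R), (1 <= s)%N -> 0 < p < 1 ->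
      [/\ (forall n : nat, admissible p s n ->
             (forall v : R, 0 < v ->
                exists! X : 'M[R]_(n + n), lyapunov p v s X)
             /\ (exists! v : R, is_vopt p s n v)),
          (fun n : nat => (\tr (lyapX p (vopt p s n) s n) / n%:R ^+ 3)%:E)
            @ within (admissible p s) \oo --> xi p s
        & off_node p s -> xi p s \is a fin_num].
Proof.
(* Convergence and finiteness are put into one predicate, so that the chosen value has both without
   any appeal to uniqueness of the limit. *)
pose limit (p : R) s (l : \bar R) :=
  (fun n : nat => (\tr (lyapX p (vopt p s n) s n) / n%:R ^+ 3)%:E)
    @ within (admissible p s) \oo --> l /\ (off_node p s -> l \is a fin_num).
exists (fun p s => xget 0%E (limit p s)) => s p s_gt0 p01.
have [|cT fin] := @xgetPex _ 0%E (limit p s).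
  have [off|on] := pselect (off_node p s).
    by have [l lP] := off_node_cvg s_gt0 off; exists l%:E; split.
  by exists +oo%E; split=> //; exact: on_node_cvg.
split=> // n adm; split=> [v v0|].
  exists (lyapX p v s n); split=> [|X XP].
    by apply/(lyapunov_sol adm _ v0); exact: lyapX_sol.
  by rewrite (lyapX_sol adm v0); apply/esym/(lyapunov_sol adm _ v0).
exists (vmin p s n); split=> [|v /(is_voptE adm s_gt0) //].
exact/(is_voptE adm s_gt0).
Qed.
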